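(* For $n\ge2$ let $X=\mathbb{P}\big(\mathcal{O}_{\mathbb{P}^{n-1}}\oplus\mathcal{O}_{\mathbb{P}^{n-1}}(n-1)\big)$, let $L=c_1(\mathcal{O}_X(1))$, let $H$ be the pullback of the hyperplane class of $\mathbb{P}^{n-1}$, and for $\alpha,\beta>0$ let $\Omega_{\alpha,\beta}=\alpha L+\beta H$ (a K\''ahler class on $X$). Define $$f(n,\alpha,\beta):=2(n+1)\,\Omega_{\alpha,\beta}^n\big[n\,c_1^2\Omega_{\alpha,\beta}^{n-2}-(n+2)\,c_2\Omega_{\alpha,\beta}^{n-2}\big]-n^2\big(c_1\Omega_{\alpha,\beta}^{n-1}\big)^2.$$ Then for every $\alpha,\beta>0$ there exists a positive integer $N(\alpha,\beta)$ such that $f(n,\alpha,\beta)>0$ for all $n\ge N(\alpha,\beta)$. Consequently, for such $n$, $$8(n+1)\big(n\,c_1^2\Omega_{\alpha,\beta}^{n-2}-(n+2)c_2\Omega_{\alpha,\beta}^{n-2}\big)>\frac{\big(2n\,c_1\Omega_{\alpha,\beta}^{n-1}\big)^2}{\Omega_{\alpha,\beta}^n},$$ and the K\''ahler class $\Omega_{\alpha,\beta}$ contains no K\''ahler metric of constant scalar curvature.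
   Context: $c_1,c_2$ are the Chern classes of $X$ and products of classes denote intersection numbers on $X$. The intersection ring of $X$ is generated by $L,H$ with relations $L^2=(n-1)LH$, $LH^{n-1}=1$, $H^n=0$, and $c_1=2L+H$, $c_2=2nLH-\frac{n(n-1)}{2}H^2$. *)

(* Defs.v *)
From HB Require Import structures.
From mathcomp Require Import all_boot all_order all_algebra.
From mathcomp Require Export reals.
Set Implicit Arguments. Unset Strict Implicit. Unset Printing Implicit Defensive.
Import Order.TTheory GRing.Theory Num.Theory.
Local Open Scope ring_scope.

(* Cohomology classes of X = P(O + O(n-1)) over P^{n-1} are represented as
   polynomials in two variables: outer variable L, inner variable H,
   i.e. p = \sum_i p_i(H) L^i with p : {poly {poly R}}. *)

Section Intersection.
Variable R : fieldType.

(* Intersection number of the monomial L^a H^b on X (dim n), determined by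
   the relations L^2 = (n-1) L H, L H^{n-1} = 1, H^n = 0:
   L^a H^b = (n-1)^(a-1) if a >= 1 and a+b = n, H^n = 0, and 0 when a+b <> n. *)
Definition ideg (n a b : nat) : R :=
  if (a + b == n)%N then (if a == 0%N then 0 else ((n - 1)%N%:R) ^+ a.-1) else 0.

Definition inum (n : nat) (p : {poly {poly R}}) : R :=
  \sum_(i < size p) \sum_(j < size p`_i) (p`_i)`_j * ideg n i j.

Definition clL : {poly {poly R}} := 'X.
Definition clH : {poly {poly R}} := ('X)%:P.

Definition chern1 : {poly {poly R}} := clL *+ 2 + clH.
Definition chern2 (n : nat) : {poly {poly R}} :=
  ((2 * n)%N%:R)%:P%:P * (clL * clH)
  - (((n * (n - 1))%N%:R / 2%:R))%:P%:P * (clH ^+ 2).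

Definition Omega (a b : R) : {poly {poly R}} := a%:P%:P * clL + b%:P%:P * clH.

Definition fnab (n : nat) (a b : R) : R :=
  2%:R * (n.+1)%:R * inum n (Omega a b ^+ n)
    * (n%:R * inum n (chern1 ^+ 2 * Omega a b ^+ (n - 2))
       - (n + 2)%N%:R * inum n (chern2 n * Omega a b ^+ (n - 2)))
  - (n%:R) ^+ 2 * (inum n (chern1 * Omega a b ^+ (n - 1))) ^+ 2.

End Intersection.

(* Main.v *)
Require Import Defs.
From HB Require Import structures.
From mathcomp Require Import all_boot all_order all_algebra.
From mathcomp Require Import reals ring lra.
Set Implicit Arguments.
Unset Strict Implicit.
Unset Printing Implicit Defensive.
Import Order.TTheory GRing.Theory Num.Theory.
Local Open Scope ring_scope.

(* On X the monomials satisfy L^j H^r = (n-1)^(j-1) for j >= 1, j + r = n, and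
   H^n = 0.  Hence, with x = n - 1 and T = x alpha + beta, the intersection
   number of L^j H^r Omega^s is x^(j-1) T^s for j >= 1 and (T^s - beta^s) / x
   for j = 0, so every term of f is explicit in x, T and beta.  Putting
   beta = e T, f x^2 becomes (x + 1) T^(2n-2) times a polynomial in x, e and
   e^(n-2) that equals (x - 1)^2 (x + 3) at e = 0.  As e = beta / T tends to 0
   when n grows, f is eventually positive; the second inequality is f > 0
   divided by Omega^n > 0. *)

Lemma sum_ord_widen0 (V : nmodType) (F : nat -> V) m n : (m <= n)%N ->
  (forall i, (m <= i)%N -> F i = 0) -> \sum_(i < m) F i = \sum_(i < n) F i.
Proof.
move=> le_mn F0; rewrite (big_ord_widen n F le_mn) big_mkcond.
by apply: eq_bigr => i _; case: ltnP => // /F0 ->.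
Qed.

Section IntersectionNumbers.
Variable R : fieldType.
Implicit Types (n : nat) (p q : {poly {poly R}}).

Lemma ideg_eq0 n i j : (i + j != n)%N -> ideg R n i j = 0.
Proof. by rewrite /ideg => /negbTE ->. Qed.

Lemma inumE n p : inum n p = \sum_(i < n.+1) (p`_i)`_(n - i) * ideg R n i (n - i).
Proof.
have inner i (q : {poly R}) :
    \sum_(j < size q) q`_j * ideg R n i j = q`_(n - i) * ideg R n i (n - i).
  rewrite (@sum_ord_widen0 _ (fun j => q`_j * ideg R n i j) _ (maxn (size q) (n - i).+1))
    ?leq_maxl //; last first.
    by move=> j /(nth_default 0) ->; rewrite mul0r.
  have lt_ni : (n - i < maxn (size q) (n - i).+1)%N by rewrite leq_max ltnSn orbT.
  rewrite (bigD1 (Ordinal lt_ni)) //= big1 ?addr0 // => j ne_j.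
  rewrite ideg_eq0 ?mulr0 //; apply: contra ne_j => /eqP def_n.
  by rewrite -val_eqE /=; apply/eqP; rewrite -{2}def_n addKn.
rewrite /inum; under eq_bigr do rewrite inner.
set F := fun i => (p`_i)`_(n - i) * ideg R n i (n - i).
rewrite (@sum_ord_widen0 _ F _ (maxn (size p) n.+1)) ?leq_maxl //; last first.
  by move=> i /(nth_default 0) p_i0; rewrite /F p_i0 coef0 mul0r.
rewrite -(@sum_ord_widen0 _ F n.+1) ?leq_maxr // => i lt_ni.
by rewrite /F ideg_eq0 ?mulr0 // (eqnP (ltnW lt_ni)) addn0 gtn_eqF.
Qed.

Lemma inumD n p q : inum n (p + q) = inum n p + inum n q.
Proof. by rewrite !inumE -big_split; apply: eq_bigr => i _; rewrite !coefD mulrDl. Qed.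

Lemma inumN n p : inum n (- p) = - inum n p.
Proof. by rewrite !inumE -sumrN; apply: eq_bigr => i _; rewrite !coefN mulNr. Qed.

Lemma inumB n p q : inum n (p - q) = inum n p - inum n q.
Proof. by rewrite inumD inumN. Qed.

Lemma inumCM n (c : R) p : inum n (c%:P%:P * p) = c * inum n p.
Proof. by rewrite !inumE mulr_sumr; apply: eq_bigr => i _; rewrite !coefCM mulrA. Qed.

Lemma inum_monomial n j r : inum n (clL R ^+ j * clH R ^+ r) = ideg R n j r.
Proof.
have coef_LH i k : ((clL R ^+ j * clH R ^+ r)`_i)`_k = ((i == j) && (k == r))%:R.
  rewrite /clL /clH -rmorphXn coefMC coefXn.
  by case: (i == j); rewrite ?mul1r ?mul0r ?coefXn ?coef0.
rewrite inumE; under eq_bigr do rewrite coef_LH.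
have [le_jn | lt_nj] := leqP j n; last first.
  rewrite big1 ?ideg_eq0 ?gtn_eqF ?ltn_addr // => i _.
  by rewrite (ltn_eqF (leq_trans (ltn_ord i) lt_nj)) mul0r.
rewrite (bigD1 (Ordinal (le_jn : (j < n.+1)%N))) //= big1 ?addr0 => [|i ne_ij]; last first.
  by rewrite -val_eqE /= in ne_ij; rewrite (negbTE ne_ij) mul0r.
rewrite eqxx /=; have [<- | ne_r] := eqVneq (n - j)%N r; first by rewrite mul1r.
by rewrite mul0r ideg_eq0 //; apply: contra ne_r => /eqP <-; rewrite addKn.
Qed.

End IntersectionNumbers.

Section OmegaPowers.
Variables (R : fieldType) (a b : R).

Lemma monomial_OmegaS j r s :
  clL R ^+ j * clH R ^+ r * Omega a b ^+ s.+1 =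
  a%:P%:P * (clL R ^+ j.+1 * clH R ^+ r * Omega a b ^+ s)
  + b%:P%:P * (clL R ^+ j * clH R ^+ r.+1 * Omega a b ^+ s).
Proof. by rewrite /Omega exprSr !exprS; ring. Qed.

Lemma inum_monomial_Omega n j r s : (j + r + s = n)%N ->
  inum n (clL R ^+ j * clH R ^+ r * Omega a b ^+ s) * (n.-1)%:R =
  if j is 0 then ((n.-1)%:R * a + b) ^+ s - b ^+ s
  else (n.-1)%:R ^+ j * ((n.-1)%:R * a + b) ^+ s.
Proof.
elim: s j r => [|s IHs] j r def_n.
  rewrite expr0 mulr1 inum_monomial /ideg -def_n addn0 eqxx.
  case: j {def_n} => [|j] /=; first by rewrite mul0r subrr.
  by rewrite expr0 mulr1 addSn subn1 -exprSr.
rewrite (monomial_OmegaS j r s) inumD !inumCM mulrDl -[a * _ * _]mulrA -[b * _ * _]mulrA.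
rewrite IHs; last by rewrite -def_n addnS addSn.
rewrite IHs; last by rewrite -def_n !addnS.
by case: j {def_n} => [|j] /=; rewrite !exprS; ring.
Qed.

End OmegaPowers.

Section ClosedForms.
Variables (R : fieldType) (a b : R) (m : nat).
Let x : R := m.+1%:R.
Let T : R := x * a + b.

Lemma inum_Omega_top : inum m.+2 (Omega a b ^+ m.+2) * x = T ^+ m.+2 - b ^+ m.+2.
Proof.
by have := @inum_monomial_Omega R a b m.+2 0 0 m.+2 erefl; rewrite !expr0 !mul1r.
Qed.

Lemma inum_chern1_Omega :
  inum m.+2 (chern1 R * Omega a b ^+ (m.+2 - 1)) * x
  = (2%:R * x + 1) * T ^+ m.+1 - b ^+ m.+1.
Proof.
rewrite subn1 /= (_ : chern1 R * _ =
  (clL R ^+ 1 * clH R ^+ 0 * Omega a b ^+ m.+1) *+ 2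
  + clL R ^+ 0 * clH R ^+ 1 * Omega a b ^+ m.+1); last by rewrite /chern1; ring.
rewrite !inumD !mulrDl !inum_monomial_Omega //=.
by rewrite -/x -/T; ring.
Qed.

Lemma inum_chern1_sq_Omega :
  inum m.+2 (chern1 R ^+ 2 * Omega a b ^+ (m.+2 - 2)) * x
  = (2%:R * x + 1) ^+ 2 * T ^+ m - b ^+ m.
Proof.
rewrite subSS subSS subn0 (_ : chern1 R ^+ 2 * _ =
  (clL R ^+ 2 * clH R ^+ 0 * Omega a b ^+ m) *+ 4
  + (clL R ^+ 1 * clH R ^+ 1 * Omega a b ^+ m) *+ 4
  + clL R ^+ 0 * clH R ^+ 2 * Omega a b ^+ m); last by rewrite /chern1; ring.
rewrite !inumD !mulrDl !inum_monomial_Omega ?addn0 //=.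
by rewrite -/x -/T; ring.
Qed.

Lemma inum_chern2_Omega :
  inum m.+2 (chern2 R m.+2 * Omega a b ^+ (m.+2 - 2)) * x
  = (x + 1) * x * (2%:R * T ^+ m - (T ^+ m - b ^+ m) / 2%:R).
Proof.
rewrite subSS subSS subn0 (_ : chern2 R m.+2 * _ =
  ((2 * m.+2)%N%:R)%:P%:P * (clL R ^+ 1 * clH R ^+ 1 * Omega a b ^+ m)
  - (((m.+2 * (m.+2 - 1))%N%:R / 2%:R))%:P%:P
    * (clL R ^+ 0 * clH R ^+ 2 * Omega a b ^+ m)); last by rewrite /chern2; ring.
rewrite inumB !inumCM mulrBl -!(mulrA _ (inum _ _)) !inum_monomial_Omega ?addn0 //=.
by rewrite subn1 /= !natrM -/x -natr1 -/T; ring.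
Qed.

End ClosedForms.

Section Positivity.
Variable R : realFieldType.
Implicit Types x e d : R.

Definition fnab_reduced x e d : R :=
  2%:R * (x + 2%:R) * (1 - e ^+ 2 * d)
    * ((2%:R * x + 1) ^+ 2 - d - x * (x + 3%:R) * (3%:R + d) / 2%:R)
  - (x + 1) * (2%:R * x + 1 - e * d) ^+ 2.

(* (x - 1)^2 (x + 3) is the value of fnab_reduced at e = d = 0; the second
   term bounds what positive e and d can cost. *)
Lemma fnab_reduced_ge x e d : 0 <= x -> 0 <= d -> d <= e -> e <= 1 ->
  (x - 1) ^+ 2 * (x + 3%:R) - 2%:R * e * (x + 2%:R) * (3%:R * x ^+ 2 + x + 2%:R)
  <= fnab_reduced x e d.
Proof.
move=> x_ge0 d_ge0 le_de le_e1.
set K := (2%:R * x + 1) ^+ 2 - x * (x + 3%:R) * 3%:R / 2%:R.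
set M := 1 + x * (x + 3%:R) / 2%:R.
have K_ge0 : 0 <= K by rewrite /K; nra.
have M_ge0 : 0 <= M by rewrite /M; nra.
have e_ge0 : 0 <= e by lra.
have ed_ge0 : 0 <= e * d by exact: mulr_ge0.
have le_ed_e : e * d <= e by rewrite -[leRHS]mulr1 ler_wpM2l //; lra.
have le_eed_e : e ^+ 2 * d <= e.
  by rewrite expr2 -mulrA -[leRHS]mulr1 ler_wpM2l //; lra.
have middle : K - e * (K + M) <= (1 - e ^+ 2 * d) * (K - d * M).
  have : 0 <= e ^+ 2 * d * d * M by do 3![apply: mulr_ge0 => //]; exact: sqr_ge0.
  by nra.
have outer : (2%:R * x + 1 - e * d) ^+ 2 <= (2%:R * x + 1) ^+ 2 by nra.
rewrite /fnab_reduced (_ : _ - _ - _ = K - d * M); last by rewrite /K /M; field.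
have middle' : 2%:R * (x + 2%:R) * (K - e * (K + M))
    <= 2%:R * (x + 2%:R) * ((1 - e ^+ 2 * d) * (K - d * M)).
  by apply: ler_wpM2l => //; lra.
have outer' : (x + 1) * (2%:R * x + 1 - e * d) ^+ 2 <= (x + 1) * (2%:R * x + 1) ^+ 2.
  by apply: ler_wpM2l => //; lra.
have -> : (x - 1) ^+ 2 * (x + 3%:R) - 2%:R * e * (x + 2%:R) * (3%:R * x ^+ 2 + x + 2%:R)
  = 2%:R * (x + 2%:R) * (K - e * (K + M)) - (x + 1) * (2%:R * x + 1) ^+ 2.
  by rewrite /K /M; field.
by rewrite -mulrA; lra.
Qed.

Lemma fnab_reduced_gt0 x e d : 2%:R <= x -> 0 <= d -> d <= e -> 100%:R * e <= 1 ->
  0 < fnab_reduced x e d.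
Proof.
move=> le2x d_ge0 le_de small_e.
have x_ge0 : 0 <= x by lra.
have le_e1 : e <= 1 by lra.
apply: (lt_le_trans _ (fnab_reduced_ge x_ge0 d_ge0 le_de le_e1)).
(* With x = y + 2 every coefficient of the bound is nonnegative, except for
   a multiple of e that 100 e <= 1 absorbs. *)
set y := x - 2%:R; have y_ge0 : 0 <= y by rewrite /y; lra.
have -> : x = y + 2%:R by rewrite /y; ring.
have y2_ge0 : 0 <= y ^+ 2 := sqr_ge0 y.
have y3_ge0 : 0 <= y ^+ 3 := exprn_ge0 3 y_ge0.
have : 0 <= e * (3%:R * y ^+ 3 + 25%:R * y ^+ 2 + 68%:R * y + 64%:R) by apply: mulr_ge0; lra.
have : e * (3%:R * y ^+ 3 + 25%:R * y ^+ 2 + 68%:R * y + 64%:R)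
    <= (3%:R * y ^+ 3 + 25%:R * y ^+ 2 + 68%:R * y + 64%:R) / 100%:R.
  by rewrite ler_pdivlMr //; nra.
have -> : (y + 2%:R - 1) ^+ 2 * (y + 2%:R + 3%:R)
    - 2%:R * e * (y + 2%:R + 2%:R) * (3%:R * (y + 2%:R) ^+ 2 + (y + 2%:R) + 2%:R)
  = y ^+ 3 + 7%:R * y ^+ 2 + 11%:R * y + 5%:R
    - 2%:R * (e * (3%:R * y ^+ 3 + 25%:R * y ^+ 2 + 68%:R * y + 64%:R)) by ring.
lra.
Qed.

Lemma sq_div_lt (A X D c k : R) : 0 < A -> 0 < 2%:R * c * A * X - k ^+ 2 * D ^+ 2 ->
  (2%:R * k * D) ^+ 2 / A < 8%:R * c * X.
Proof.
move=> A_gt0 pos; rewrite ltr_pdivrMr // exprMn (exprMn 2%:R).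
by rewrite -mulrA -(mulrA 8%:R) (mulrC _ A); nra.
Qed.

Section Reduction.
Variables (a b : R) (m : nat).
Let x : R := m.+1%:R.
Let T : R := x * a + b.

Lemma fnab_reduction e : b = e * T ->
  fnab m.+2 a b * x ^+ 2 = (x + 1) * (T ^+ m.+1) ^+ 2 * fnab_reduced x e (e ^+ m).
Proof.
move=> def_b.
have -> : fnab m.+2 a b * x ^+ 2 =
    2%:R * (x + 2%:R) * (inum m.+2 (Omega a b ^+ m.+2) * x)
    * ((x + 1) * (inum m.+2 (chern1 R ^+ 2 * Omega a b ^+ (m.+2 - 2)) * x)
       - (x + 3%:R) * (inum m.+2 (chern2 R m.+2 * Omega a b ^+ (m.+2 - 2)) * x))
    - (x + 1) ^+ 2 * (inum m.+2 (chern1 R * Omega a b ^+ (m.+2 - 1)) * x) ^+ 2.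
  by rewrite /fnab -!natr1 natrD -/x; ring.
rewrite inum_Omega_top inum_chern1_Omega inum_chern1_sq_Omega inum_chern2_Omega -/x -/T.
by rewrite def_b /fnab_reduced !exprMn !exprS; field.
Qed.

Hypotheses (a_gt0 : 0 < a) (b_ge0 : 0 <= b).

Let T_gt0 : 0 < T.
Proof. by rewrite /T ltr_wpDr // mulr_gt0 ?ltr0Sn. Qed.

Lemma inum_Omega_top_gt0 : 0 < inum m.+2 (Omega a b ^+ m.+2).
Proof.
have lt_bT : b < T by rewrite /T ltr_pwDl // mulr_gt0 ?ltr0Sn.
rewrite -(pmulr_lgt0 _ (ltr0Sn R m)) inum_Omega_top subr_gt0.
by rewrite ltrXn2r.
Qed.

Lemma fnab_gt0 : (0 < m)%N -> 100%:R * b <= T -> 0 < fnab m.+2 a b.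
Proof.
move=> m_gt0 small_b; pose e := b / T.
have def_b : b = e * T by rewrite /e divfK // gt_eqF.
have e_ge0 : 0 <= e by rewrite divr_ge0 // ltW.
have small_e : 100%:R * e <= 1 by rewrite /e mulrA ler_pdivrMr // mul1r.
have le_em_e : e ^+ m <= e by rewrite ler_iXnr //; lra.
have le2x : 2%:R <= x by rewrite /x ler_nat.
rewrite -(pmulr_lgt0 _ (exprn_gt0 2 (ltr0Sn R m))) (fnab_reduction def_b).
by rewrite !mulr_gt0 ?exprn_gt0 ?fnab_reduced_gt0 ?exprn_ge0 //; lra.
Qed.

End Reduction.

End Positivity.

Theorem proposition2p2 (R : realType) (alpha beta : R) :
  0 < alpha -> 0 < beta ->
  exists N : nat, (0 < N)%N /\
    forall n : nat, (2 <= n)%N -> (N <= n)%N ->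
      0 < fnab n alpha beta /\
      8%:R * (n.+1)%:R *
        (n%:R * inum n (chern1 R ^+ 2 * Omega alpha beta ^+ (n - 2))
         - (n + 2)%N%:R * inum n (chern2 R n * Omega alpha beta ^+ (n - 2)))
      > (2%:R * n%:R * inum n (chern1 R * Omega alpha beta ^+ (n - 1))) ^+ 2
        / inum n (Omega alpha beta ^+ n).
Proof.
move=> alpha_gt0 beta_gt0.
have r_ge0 : 0 <= 100%:R * beta / alpha by rewrite divr_ge0 ?mulr_ge0 // ltW.
exists (Num.bound (100%:R * beta / alpha)).+3; split=> // -[|[|m]] // _.
rewrite !ltnS => lt_bound_m.
have m_gt0 : (0 < m)%N by rewrite (leq_ltn_trans _ lt_bound_m).
have small_beta : 100%:R * beta <= m.+1%:R * alpha + beta.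
  have : 100%:R * beta / alpha <= m.+1%:R.
    by apply/ltW/(lt_le_trans (archi_boundP r_ge0)); rewrite ler_nat ltnW // leqW.
  by rewrite ler_pdivrMr //; lra.
have fnab_pos := fnab_gt0 alpha_gt0 (ltW beta_gt0) m_gt0 small_beta.
split=> //; exact: sq_div_lt (inum_Omega_top_gt0 m alpha_gt0 (ltW beta_gt0)) fnab_pos.
Qed.
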